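(* For every (monadic, finitary) $\pi$-term $P$, the typed solos term $[\![P]\!]$ is an acyclic solos term, with respect to the environment assigning type $W$ to every free name of $P$.
   Context: $\pi$-terms: $P ::= 0 \mid u(x).P \mid \overline{u}\langle x\rangle.P \mid (P\mid P) \mid (\nu x)P$, where $u(x).P$ and $(\nu x)P$ bind $x$ in $P$. Triadic solos terms: $P ::= 0 \mid u(x_1x_2x_3) \mid \overline{u}\langle x_1x_2x_3\rangle \mid (P\mid P) \mid (\nu x)P$, where $(\nu x)P$ binds $x$. $u(x_1x_2x_3)$ is an input solo, $\overline u\langle x_1x_2x_3\rangle$ an output solo; $u$ is its subject and the three positions $x_1,x_2,x_3$ are its object occurrences. A solo of a term means an occurrence of an input or output solo in it. Types: two types $V$ and $W$; typed terms are solos terms whose restrictions carry a type, $(\nu x^U)P$ with $U\in\{V,W\}$. An environment $\Gamma$ is a finite map from names to types; $\Gamma,x:U$ is its extension by a fresh name $x$. Typing judgments $\Gamma\vdash P$ are derived by: $\Gamma\vdash 0$; from $\Gamma\vdash P$ and $\Gamma\vdash Q$ infer $\Gamma\vdash P\mid Q$; from $\Gamma,x:U\vdash P$ infer $\Gamma\vdash(\nu x^U)P$; and for a solo (input or output) with subject $u$ and objects $a,b,c$, $\Gamma\vdash$ the solo whenever $\Gamma$ is defined on $u,a,b,c$ and $(\Gamma(u),\Gamma(a),\Gamma(b),\Gamma(c))$ is $(V,W,W,V)$ or $(W,W,V,V)$. Communication protocols: given $\Gamma\vdash P$, every object occurrence in $P$ receives a protocol $\mathsf S$ (send) or $\mathsf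 R$ (receive), determined by the polarity of its solo and the type of the subject (under $\Gamma$ extended by enclosing restriction annotations): input solo with subject of type $V$: objects get $\mathsf R,\mathsf S,\mathsf S$ in order; input with subject of type $W$: $\mathsf R,\mathsf S,\mathsf R$; output with subject of type $V$: $\mathsf S,\mathsf R,\mathsf R$; output with subject of type $W$: $\mathsf S,\mathsf R,\mathsf S$. An $\mathsf X$-occurrence of $x$ is an object occurrence of $x$ with protocol $\mathsf X$. Relations on solos $s,t$ of $P$ (bound names of $P$ being chosen, by $\alpha$-conversion, pairwise distinct and distinct from free names): $x\in s$ iff $x$ has an object occurrence in $s$; $s\triangleleft x$ iff $x$ has an $\mathsf R$-occurrence in $s$; $s\triangleleft t$ iff $s\triangleleft \mathrm{subj}(t)$; $s\perp t$ iff $s,t$ have the same subject and one is input, the other output; $s$ is a root iff there is no solo $t$ with $t\triangleleft s$. $\triangleleft^\star$ is the reflexive transitive closure and $\triangleleft^+$ the transitive closure of $\triangleleft$. An acyclic solos term (with respect to $\Gamma$) is a typed term $P$ with $\Gamma\vdash P$ such that, for the induced protocols: (AC1) each name has at most one $\mathsf R$-occurrence; (AC2) $s\perp t$ implies that $s$ and $t$ are roots; (AC3) $s\triangleleft x$ and $x\in t$ imply $s\triangleleft^\star t$; (AC4) if $x$ has an $\mathsf S$-occurrence in $s$ and $s\triangleleft x$ then $s$ is an input solo; (AC5) no free name of $P$ has an $\mathsf R$-occurrence. Translation (with fresh names $w,y,z,v'$ each time): $C(v) := (\nu z^W)\, v(zzv)$; $[\![0]\!]_v:=0$; $[\![u(x).P]\!]_v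 := (\nu w^W)(\nu y^V)(\overline v\langle uwy\rangle \mid C(y) \mid (\nu x^W)(\nu v'^V)(w(xvv')\mid [\![P]\!]_{v'}))$; $[\![\overline u\langle x\rangle.P]\!]_v := (\nu w^W)(\nu y^V)(\overline v\langle uwy\rangle \mid C(y) \mid (\nu v'^V)(\overline w\langle xv'v\rangle\mid [\![P]\!]_{v'}))$; $[\![P\mid Q]\!]_v := [\![P]\!]_v\mid[\![Q]\!]_v$; $[\![(\nu x)P]\!]_v := (\nu x^W)[\![P]\!]_v$; $[\![P]\!] := (\nu v^V)([\![P]\!]_v\mid C(v))$. *)

(* Defs.v *)
From HB Require Import structures.
From mathcomp Require Import all_boot finmap.

Set Implicit Arguments.
Unset Strict Implicit.
Unset Printing Implicit Defensive.

Local Open Scope fset_scope.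
Local Open Scope fmap_scope.

Definition name := nat.

Definition fresh (A : {fset name}) : name := (\max_(x <- A) x).+1.

Lemma fresh_notin (A : {fset name}) : fresh A \notin A.
Proof.
apply/negP => h.
by have := @leq_bigmax_seq name (enum_fset A) xpredT id _ h isT; rewrite ltnn.
Qed.

Inductive pi_term : Type :=
| PNil
| PIn of name & name & pi_term        (* [PIn u x P] is u(x).P *)
| POut of name & name & pi_term       (* [POut u x P] is the output of x on u, then P *)
| PPar of pi_term & pi_term
| PNu of name & pi_term.

Fixpoint pi_fn (P : pi_term) : {fset name} :=
  match P with
  | PNil => fset0
  | PIn u x P => u |` (pi_fn P `\ x)
  | POut u x P => u |` (x |` pi_fn P)
  | PPar P Q => pi_fn P `|` pi_fn Q
  | PNu x P => pi_fn P `\ x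
  end.

(* Every name written in the term, bound or free; the translation picks its
   new names outside this set, so that no binder captures them. *)
Fixpoint pi_names (P : pi_term) : {fset name} :=
  match P with
  | PNil => fset0
  | PIn u x P | POut u x P => u |` (x |` pi_names P)
  | PPar P Q => pi_names P `|` pi_names Q
  | PNu x P => x |` pi_names P
  end.

Variant ty := V | W.
Variant polarity := Input | Output.

Inductive sterm : Type :=
| SNil
| SSolo of polarity & name & name & name & name
| SPar of sterm & sterm
| SNu of name & ty & sterm.

Notation SIn := (SSolo Input).
Notation SOut := (SSolo Output).

Fixpoint fn (P : sterm) : {fset name} :=
  match P with
  | SNil => fset0
  | SSolo _ u a b c => [fset u; a; b; c]
  | SPar P Q => fn P `|` fn Q
  | SNu x _ P => fn P `\ x
  end.

(* One entry per restriction, so repetitions are recorded. *)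
Fixpoint bn (P : sterm) : seq name :=
  match P with
  | SNil | SSolo _ _ _ _ _ => [::]
  | SPar P Q => bn P ++ bn Q
  | SNu x _ P => x :: bn P
  end.

Definition well_named (P : sterm) : Prop :=
  uniq (bn P) /\ (forall x, x \in bn P -> x \notin fn P).

(* [e] lists the pairs of binders crossed so far, innermost first; two names
   match when they refer to the same pair, or are the same free name. *)
Fixpoint same_name (e : seq (name * name)) (x y : name) : bool :=
  match e with
  | [::] => x == y
  | (a, b) :: e' =>
      if (x == a) || (y == b) then (x == a) && (y == b) else same_name e' x y
  end.

Inductive alpha_in : seq (name * name) -> sterm -> sterm -> Prop :=
| alpha_nil e : alpha_in e SNil SNil
| alpha_solo e p u a b c u' a' b' c' :
    same_name e u u' -> same_name e a a' ->
    same_name e b b' -> same_name e c c' ->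
    alpha_in e (SSolo p u a b c) (SSolo p u' a' b' c')
| alpha_par e P Q P' Q' :
    alpha_in e P P' -> alpha_in e Q Q' -> alpha_in e (SPar P Q) (SPar P' Q')
| alpha_nu e x y U P Q :
    alpha_in ((x, y) :: e) P Q -> alpha_in e (SNu x U P) (SNu y U Q).

Definition alpha_eq : sterm -> sterm -> Prop := alpha_in [::].

Definition env := {fmap name -> ty}.

Inductive typed : env -> sterm -> Prop :=
| typed_nil G : typed G SNil
| typed_par G P Q : typed G P -> typed G Q -> typed G (SPar P Q)
| typed_nu (G : env) x U P :
    x \notin domf G -> typed G.[x <- U] P -> typed G (SNu x U P)
| typed_soloV (G : env) p u a b c :
    G.[? u] = Some V -> G.[? a] = Some W -> G.[? b] = Some W ->
    G.[? c] = Some V -> typed G (SSolo p u a b c)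
| typed_soloW (G : env) p u a b c :
    G.[? u] = Some W -> G.[? a] = Some W -> G.[? b] = Some V ->
    G.[? c] = Some V -> typed G (SSolo p u a b c).

Variant protocol := Send | Receive.

Definition is_send (X : protocol) : bool := if X is Send then true else false.
Definition of_send (b : bool) : protocol := if b then Send else Receive.
Lemma is_sendK : cancel is_send of_send. Proof. by case. Qed.
HB.instance Definition _ := Equality.copy protocol (can_type is_sendK).

Definition protocols (p : polarity) (U : ty) : seq protocol :=
  match p, U with
  | Input, V => [:: Receive; Send; Send]
  | Input, W => [:: Receive; Send; Receive]
  | Output, V => [:: Send; Receive; Receive]
  | Output, W => [:: Send; Receive; Send]
  end.

(* An occurrence of a solo, with the type of its subject in the environment
   extended by the enclosing restrictions ([None] only in untypable terms). *)
Record solo := Solo {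
  pol : polarity;
  subj : name;
  objs : seq name;
  subj_ty : option ty
}.

Fixpoint solos (G : env) (P : sterm) : seq solo :=
  match P with
  | SNil => [::]
  | SSolo p u a b c => [:: Solo p u [:: a; b; c] G.[? u]]
  | SPar P Q => solos G P ++ solos G Q
  | SNu x U P => solos G.[x <- U] P
  end.

Definition occs (s : solo) : seq (name * protocol) :=
  if subj_ty s is Some U then zip (objs s) (protocols (pol s) U) else [::].

(* The solos of a term are the positions in the list [S] of its solos, so that
   equal solos occurring at different places are kept apart. *)
Definition solo_at (S : seq solo) (i : 'I_(size S)) : solo := tnth (in_tuple S) i.

Definition occurs_in (S : seq solo) (x : name) (i : 'I_(size S)) : bool :=
  x \in objs (solo_at i).

Definition has_occ (S : seq solo) (X : protocol) (x : name) (i : 'I_(size S)) :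
  bool := (x, X) \in occs (solo_at i).

Definition tri_name (S : seq solo) (i : 'I_(size S)) (x : name) : bool :=
  has_occ Receive x i.

Definition tri (S : seq solo) : rel 'I_(size S) :=
  fun i j => tri_name i (subj (solo_at j)).

Definition tri_star (S : seq solo) : rel 'I_(size S) := connect (@tri S).

Definition perp (S : seq solo) (i j : 'I_(size S)) : Prop :=
  subj (solo_at i) = subj (solo_at j) /\ pol (solo_at i) <> pol (solo_at j).

Definition is_root (S : seq solo) (i : 'I_(size S)) : Prop :=
  ~ exists j : 'I_(size S), tri j i.

Definition AC1 (S : seq solo) : Prop :=
  forall x : name, count_mem (x, Receive) (flatten (map occs S)) <= 1.

Definition AC2 (S : seq solo) : Prop :=
  forall i j : 'I_(size S), perp i j -> is_root i /\ is_root j.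

Definition AC3 (S : seq solo) : Prop :=
  forall (i j : 'I_(size S)) (x : name),
    tri_name i x -> occurs_in x j -> tri_star i j.

Definition AC4 (S : seq solo) : Prop :=
  forall (i : 'I_(size S)) (x : name),
    has_occ Send x i -> tri_name i x -> pol (solo_at i) = Input.

Definition AC5 (free : {fset name}) (S : seq solo) : Prop :=
  forall (i : 'I_(size S)) (x : name), x \in free -> ~ has_occ Receive x i.

Definition acyclic_conditions (G : env) (P : sterm) : Prop :=
  let S := solos G P in
  [/\ AC1 S, AC2 S, AC3 S, AC4 S & AC5 (fn P) S].

(* Terms are taken up to alpha-conversion: typing (whose restriction rule asks
   for a name fresh for the environment) and the relations between solos (which
   compare names) are read on a representative whose bound names are pairwise
   distinct and distinct from the free names. *)
Definition acyclic (G : env) (P : sterm) : Prop :=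
  exists Q : sterm,
    [/\ alpha_eq P Q, well_named Q, typed G Q & acyclic_conditions G Q].

Definition C (v : name) : sterm :=
  let z := fresh [fset v] in SNu z W (SIn v z z v).

(* Meant for [v] outside [pi_names P]. *)
Fixpoint trans_at (P : pi_term) (v : name) : sterm :=
  match P with
  | PNil => SNil
  | PIn u x P' =>
      let A := v |` pi_names P in
      let w := fresh A in
      let y := fresh (w |` A) in
      let v' := fresh (y |` (w |` A)) in
      SNu w W (SNu y V
        (SPar (SPar (SOut v u w y) (C y))
              (SNu x W (SNu v' V (SPar (SIn w x v v') (trans_at P' v'))))))
  | POut u x P' =>
      let A := v |` pi_names P in
      let w := fresh A in
      let y := fresh (w |` A) in
      let v' := fresh (y |` (w |` A)) in
      SNu w W (SNu y V
        (SPar (SPar (SOut v u w y) (C y))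
              (SNu v' V (SPar (SOut w x v' v) (trans_at P' v')))))
  | PPar P1 P2 => SPar (trans_at P1 v) (trans_at P2 v)
  | PNu x P' => SNu x W (trans_at P' v)
  end.

Definition trans (P : pi_term) : sterm :=
  let v := fresh (pi_names P) in SNu v V (SPar (trans_at P v) (C v)).

Definition free_env (P : pi_term) : env := [fmap _ : pi_fn P => W].

(* Main.v *)
Require Import Defs.
From HB Require Import structures.
From mathcomp Require Import all_boot finmap zify.

Set Implicit Arguments.
Unset Strict Implicit.
Unset Printing Implicit Defensive.

Local Open Scope fset_scope.
Local Open Scope fmap_scope.
Local Open Scope nat_scope.

(**
  In the translation, numbering the restrictions from left to right makes the
  received names of the solos, read in the same order, a subsequence of the
  bound names: this gives AC1 and AC5.  A solo with subject [v] in [[[P]]_v] is an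
  output, and the other subjects are bound names carrying a single polarity, so
  only the outermost [v], which is never received, can be the subject of two
  solos of opposite polarities (AC2).  Every solo of [[[P]]_v] is reached from one
  with subject [v]; hence the solo receiving [v] reaches the whole scope of the
  names it receives (AC3).
*)

(** * Solos as an equality type *)

Definition is_input (p : polarity) : bool := if p is Input then true else false.
Definition of_input (b : bool) : polarity := if b then Input else Output.
Lemma is_inputK : cancel is_input of_input. Proof. by case. Qed.
HB.instance Definition _ := Equality.copy polarity (can_type is_inputK).

Definition is_V (U : ty) : bool := if U is V then true else false.
Definition of_V (b : bool) : ty := if b then V else W.
Lemma is_VK : cancel is_V of_V. Proof. by case. Qed.
HB.instance Definition _ := Equality.copy ty (can_type is_VK).

Definition tuple_of_solo (s : solo) := (pol s, subj s, objs s, subj_ty s).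
Definition solo_of_tuple (q : polarity * name * seq name * option ty) : solo :=
  let: (p, u, xs, U) := q in Solo p u xs U.
Lemma tuple_of_soloK : cancel tuple_of_solo solo_of_tuple. Proof. by case. Qed.
HB.instance Definition _ := Equality.copy solo (can_type tuple_of_soloK).

(** * Acyclicity conditions on lists of solos *)

Definition received (s : solo) : seq name :=
  [seq o.1 | o <- occs s & o.2 == Receive].

Lemma mem_received s x : ((x, Receive) \in occs s) = (x \in received s).
Proof.
apply/idP/mapP => [xs|[[y X] /=]]; first by exists (x, Receive); rewrite // mem_filter.
by rewrite mem_filter => /andP[/eqP /= -> ys ->].
Qed.

Definition tri_solo : rel solo := fun s t => subj t \in received s.

(** Paths run through solos as values rather than through positions in [S], so they transfer to a
    larger list without reindexing. Only the vertices after the starting point are required to lie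
    in [S]. *)
Definition reach (S : seq solo) (s t : solo) : Prop :=
  exists2 p, path tri_solo s p & t = last s p /\ {subset p <= S}.

Lemma reach_refl S s : reach S s s.
Proof. by exists [::]. Qed.

Lemma reach_step S s t u :
  tri_solo s t -> t \in S -> reach S t u -> reach S s u.
Proof.
move=> st tS [p tp [-> pS]]; exists (t :: p); rewrite /= ?st //; split=> // r.
by rewrite inE => /orP[/eqP->|/pS].
Qed.

Lemma reach_sub S1 S2 s t : {subset S1 <= S2} -> reach S1 s t -> reach S2 s t.
Proof. by move=> S12 [p sp [-> pS]]; exists p => //; split=> // r /pS/S12. Qed.

Lemma mem_solo_at S (i : 'I_(size S)) : solo_at i \in S.
Proof. by rewrite /solo_at (mem_tnth i (in_tuple S)). Qed.

Lemma solo_at_ex S s : s \in S -> exists i : 'I_(size S), solo_at i = s.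
Proof. by move=> /(tnthP (in_tuple S))[i ->]; exists i. Qed.

(** The path is lifted one vertex at a time, each value being given some position that carries it.
    Duplicate-freeness is what forces the final position to be [j] itself. *)
Lemma reach_tri_star S (i j : 'I_(size S)) :
  uniq S -> reach S (solo_at i) (solo_at j) -> tri_star i j.
Proof.
move=> uS [p]; elim: p i => [|s p IH] i /=.
  move=> _ [/eqP eq_ij _].
  have /tuple_uniqP inj : uniq (in_tuple S) by [].
  by rewrite (inj _ _ (eqP eq_ij)); apply: connect0.
move=> /andP[is_ sp] [jE pS].
have [k ks] := solo_at_ex (pS s (mem_head _ _)).
apply: (@connect_trans _ _ k).
  by apply: connect1; rewrite /tri /tri_name /has_occ mem_received ks.
by apply: IH; rewrite ks //; split=> // r rp; apply: pS; rewrite inE rp orbT.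
Qed.

(** A repeated element would contribute the members of its nonempty image twice to the flattened
    list. *)
Lemma uniq_flatten_map (T U : eqType) (f : T -> seq U) (S : seq T) :
  uniq (flatten (map f S)) -> {in S, forall s, f s != [::]} -> uniq S.
Proof.
elim: S => //= s S IH; rewrite cat_uniq => /and3P[_ sS uS] nS.
rewrite IH // ?andbT; last by move=> t tS; apply: nS; rewrite inE tS orbT.
apply/negP => s_in; move: (nS s (mem_head _ _)) sS.
case fs: (f s) => [|x l] // _ /hasPn /(_ x).
rewrite mem_head => /(_ _)/negP; apply=> //.
by apply/flatten_mapP; exists s; rewrite ?fs ?mem_head.
Qed.

Lemma count_received (S : seq solo) x :
  count_mem (x, Receive) (flatten (map occs S))
  = count_mem x (flatten (map received S)).
Proof.
elim: S => //= s S IH; rewrite !count_cat IH /received count_map count_filter.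
by congr addn; apply: eq_count => -[y X].
Qed.

(** Passes from conditions on positions to conditions on solos as values. This is sound because
    every solo receives some name and no name is received twice, so no solo value occurs at two
    positions. *)
Lemma list_acyclic (F : {fset name}) (S : seq solo) :
  uniq (flatten (map received S)) ->
  {in S, forall s, received s != [::]} ->
  {in S &, forall s t, subj s = subj t -> pol s <> pol t ->
     forall r, r \in S -> ~~ tri_solo r s} ->
  {in S &, forall s t x, x \in received s -> x \in objs t -> reach S s t} ->
  {in S, forall s x, (x, Send) \in occs s -> x \in received s -> pol s = Input} ->
  {in S, forall s x, x \in received s -> x \notin F} ->
  [/\ AC1 S, AC2 S, AC3 S, AC4 S & AC5 F S].
Proof.
move=> uR nR ac2 ac3 ac4 ac5; split.
- by move=> x; rewrite count_received count_uniq_mem // leq_b1.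
- move=> i j [eq_ij ne_ij]; split=> -[k]; rewrite /tri /tri_name /has_occ
    mem_received; apply/negP.
    by apply: (ac2 _ (solo_at j)); rewrite ?mem_solo_at.
  by apply: (ac2 _ (solo_at i)); rewrite ?mem_solo_at // => e; apply: ne_ij.
- move=> i j x; rewrite /tri_name /has_occ /occurs_in mem_received => xi xj.
  apply: reach_tri_star; first exact: uniq_flatten_map uR nR.
  by apply: ac3 xi xj; apply: mem_solo_at.
- move=> i x xS; rewrite /tri_name /has_occ mem_received => xR.
  exact: ac4 (mem_solo_at i) _ xS xR.
- move=> i x xF; rewrite /has_occ mem_received => /(ac5 _ (mem_solo_at i)).
  by rewrite xF.
Qed.

(** * A well-named representative of the translation *)

(** An input prefix accounts for five restrictions: [w], [y], the [z] inside [C(y)], [x] and [v'].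
    An output prefix has no [x] among them. *)
Fixpoint nbinders (P : pi_term) : nat :=
  match P with
  | PNil => 0
  | PIn _ _ P => (nbinders P).+1.+4
  | POut _ _ P => (nbinders P).+4
  | PPar P Q => nbinders P + nbinders Q
  | PNu _ P => (nbinders P).+1
  end.

(* The binders are numbered from [k] on, in the order of [bn]; [r] renames the
   free names of the pi-term to names below [k]. *)
Fixpoint rep_at (r : name -> name) (P : pi_term) (v k : name) : sterm :=
  match P with
  | PNil => SNil
  | PIn u x P =>
      SNu k W (SNu k.+1 V
        (SPar (SPar (SOut v (r u) k k.+1) (SNu k.+2 W (SIn k.+1 k.+2 k.+2 k.+1)))
              (SNu k.+3 W (SNu k.+4 V (SPar (SIn k k.+3 v k.+4)
                 (rep_at [eta r with x |-> k.+3] P k.+4 k.+1.+4))))))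
  | POut u x P =>
      SNu k W (SNu k.+1 V
        (SPar (SPar (SOut v (r u) k k.+1) (SNu k.+2 W (SIn k.+1 k.+2 k.+2 k.+1)))
              (SNu k.+3 V (SPar (SOut k (r x) k.+3 v) (rep_at r P k.+3 k.+4)))))
  | PPar P Q => SPar (rep_at r P v k) (rep_at r Q v (k + nbinders P))
  | PNu x P => SNu k W (rep_at [eta r with x |-> k] P v k.+1)
  end.

(** The outermost [v] exceeds every free name of [P], so the identity renaming is compatible with
    numbering upwards from [v.+1]; the final [C(v)] takes the first number left over. *)
Definition rep (P : pi_term) : sterm :=
  let v := fresh (pi_fn P) in
  let z := v.+1 + nbinders P in
  SNu v V (SPar (rep_at id P v v.+1) (SNu z W (SIn v z z v))).

Lemma bn_rep_at P r v k : bn (rep_at r P v k) = iota k (nbinders P).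
Proof.
elim: P r v k => //= [u x P IH|u x P IH|P IHP Q IHQ|x P IH] r v k; rewrite ?IH //.
by rewrite IHP IHQ iotaD.
Qed.

Definition below (r : name -> name) (P : pi_term) (k : name) : Prop :=
  forall a, a \in pi_fn P -> r a < k.

Lemma below_upd r P x k j :
  (forall a, a \in pi_fn P -> a != x -> r a < k) -> k <= j ->
  below [eta r with x |-> j] P j.+1.
Proof.
move=> rP kj a aP /=; case: eqP => [_|/eqP ax]; first by rewrite ltnS.
by apply: (leq_trans (rP a aP ax)); rewrite leqW.
Qed.

Lemma below_leq r P k j : below r P k -> k <= j -> below r P j.
Proof. by move=> rP kj a /rP/leq_trans; apply. Qed.

Lemma below_in r u x P k : below r (PIn u x P) k ->
  r u < k /\ below [eta r with x |-> k.+3] P k.+1.+4.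
Proof.
move=> rP; split; first by apply: rP; rewrite /= !inE eqxx.
apply: (@below_leq _ _ k.+4) => //; apply: (@below_upd _ _ _ k) => // [a aP ax|].
  by apply: rP; rewrite /= !inE ax aP orbT.
by lia.
Qed.

Lemma below_out r u x P k : below r (POut u x P) k ->
  [/\ r u < k, r x < k & below r P k.+4].
Proof.
move=> rP; split; try by apply: rP; rewrite /= !inE eqxx ?orbT.
apply: (@below_leq _ _ k) => [a aP|]; last by lia.
by apply: rP; rewrite /= !inE aP !orbT.
Qed.

Lemma below_par r P Q k : below r (PPar P Q) k -> below r P k /\ below r Q k.
Proof. by move=> rP; split=> a aP; apply: rP; rewrite /= !inE aP ?orbT. Qed.

Lemma below_nu r x P k : below r (PNu x P) k -> below [eta r with x |-> k] P k.+1.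
Proof.
move=> rP; apply: below_upd => [a aP ax|]; last exact: leqnn.
by apply: rP; rewrite /= !inE ax aP.
Qed.

Lemma fn_rep_at P r v k x : x \in fn (rep_at r P v k) ->
  x = v \/ exists2 a, a \in pi_fn P & x = r a.
Proof.
elim: P r v k => //= [u b P IH|u b P IH|P IHP Q IHQ|b P IH] r v k; rewrite !inE.
- have ur : exists2 a, a \in u |` pi_fn P `\ b & r u = r a.
    by exists u; rewrite ?fset1U1.
  move=> /and3P[/negPf nk /negPf nk1 /orP[/orP[]|/and3P[/negPf nk3 /negPf nk4]]].
  + by rewrite nk nk1 !orbF => /orP[/eqP->|/eqP->]; auto.
  + by rewrite nk1 !orbF orbb => /andP[/negPf->].
  + rewrite nk nk4 nk3 !orbF /= => /orP[/eqP->|]; first by auto.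
    move=> /IH[/eqP|[a aP /=]]; first by rewrite nk4.
    case: eqP => [_ /eqP|/eqP ab ->]; first by rewrite nk3.
    by right; exists a; rewrite // !inE ab aP orbT.
- have ur : exists2 a, a \in u |` (b |` pi_fn P) & r u = r a.
    by exists u; rewrite ?fset1U1.
  have br : exists2 a, a \in u |` (b |` pi_fn P) & r b = r a.
    by exists b; rewrite // !inE eqxx orbT.
  move=> /and3P[/negPf nk /negPf nk1 /orP[/orP[]|/andP[/negPf nk3]]].
  + by rewrite nk nk1 !orbF => /orP[/eqP->|/eqP->]; auto.
  + by rewrite nk1 !orbF orbb => /andP[/negPf->].
  + rewrite nk nk3 !orbF /= => /orP[/orP[/eqP->|/eqP->]|]; try by auto.
    move=> /IH[/eqP|[a aP ->]]; first by rewrite nk3.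
    by right; exists a; rewrite // !inE aP !orbT.
- by case/orP => [/IHP|/IHQ] [->|[a aP ->]]; auto; right; exists a;
    rewrite // !inE aP ?orbT.
- move=> /andP[nk /IH[->|[a aP /=]]]; first by auto.
  case: eqP => [_ /eqP|/eqP ab ->]; first by rewrite (negPf nk).
  by right; exists a; rewrite // !inE ab aP.
Qed.

Lemma ltn_fresh (A : {fset name}) a : a \in A -> a < fresh A.
Proof. by move=> aA; rewrite ltnS (@leq_bigmax_seq name (enum_fset A) xpredT id). Qed.

Lemma well_named_rep P : well_named (rep P).
Proof.
pose v := fresh (pi_fn P).
(* The two names added to the block of [rep_at] are [v] before it and [z] just after it. *)
have bnE : bn (rep P) = iota v (nbinders P).+2.
  by rewrite -[(nbinders P).+2]addn1 iotaD /= bn_rep_at addSnnS.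
rewrite /well_named bnE iota_uniq; split=> // x; rewrite mem_iota => /andP[vx _].
rewrite !inE -/v; case: eqVneq => //= nv; rewrite !orbF orbb andNb orbF.
apply/negP => /fn_rep_at[/eqP|[a /ltn_fresh aP xa]]; first by rewrite (negPf nv).
by move: vx; rewrite xa leqNgt aP.
Qed.

(** * Alpha-conversion *)

Lemma same_name_cons e a b x y :
  x != a -> y != b -> same_name e x y -> same_name ((a, b) :: e) x y.
Proof. by move=> /= /negPf-> /negPf->. Qed.

Lemma same_name_head e a b : same_name ((a, b) :: e) a b.
Proof. by rewrite /= !eqxx. Qed.

Lemma pi_fn_names P : {subset pi_fn P <= pi_names P}.
Proof.
elim: P => //= [u x P IH|u x P IH|P IHP Q IHQ|x P IH] a; rewrite !inE.
- by case: (a == u) => //= /andP[_ /IH ->]; rewrite orbT.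
- by case: (a == u) (a == x) => [] [] //= /IH.
- by case/orP => [/IHP|/IHQ] ->; rewrite ?orbT.
- by move=> /andP[_ /IH ->]; rewrite orbT.
Qed.

Ltac same_name_tac :=
  repeat first [exact: same_name_head | by [] | apply: same_name_cons; [lia|lia|]].

Lemma alpha_C e v v' k : same_name e v v' -> v' < k ->
  alpha_in e (C v) (SNu k W (SIn v' k k v')).
Proof.
move=> vv' v'k; have vz : v < fresh [fset v] by rewrite ltn_fresh ?inE.
by apply: alpha_nu; apply: alpha_solo; same_name_tac.
Qed.

(** Descending under a new pair of binders must not disturb the names matched so far. On the left
    the new name exceeds every name written in the pi-term, as well as [v]; on the right it exceeds
    [v'] and the images of the free names. The binders of the pi-term itself are not chosen fresh on
    the left, and [v \notin pi_names P] keeps them from capturing [v]. *)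
Lemma alpha_rep_at P e r v v' k :
  (forall a, a \in pi_fn P -> same_name e a (r a)) -> below r P k ->
  v \notin pi_names P -> same_name e v v' -> v' < k ->
  alpha_in e (trans_at P v) (rep_at r P v' k).
Proof.
elim: P e r v v' k => [|u x P IH|u x P IH|P IHP Q IHQ|x P IH] e r v v' k
  er rk vP vv' v'k.
- exact: alpha_nil.
- have [ru rP] := below_in rk; rewrite /trans_at -/trans_at.
  set A := v |` _; set w := fresh A; set y := fresh (w |` A).
  set v1 := fresh (y |` (w |` A)).
  have hA a : a \in A -> a < w by exact: ltn_fresh.
  have wy : w < y by rewrite ltn_fresh ?fset1U1.
  have yv1 : y < v1 by rewrite ltn_fresh ?fset1U1.
  have vw : v < w by rewrite hA ?fset1U1.
  have uw : u < w by rewrite hA // !inE eqxx orbT.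
  have xw : x < w by rewrite hA // !inE eqxx !orbT.
  have Pw a : a \in pi_names P -> a < w by move=> aP; rewrite hA // !inE aP !orbT.
  (* The solo [w(x v v')] mentions [v] under the binder of [x], which must not capture it. *)
  have xv : v != x by move: vP; rewrite /= !inE; lia.
  have uu : same_name e u (r u) by apply: er; rewrite fset1U1.
  apply: alpha_nu; apply: alpha_nu; apply: alpha_par; first apply: alpha_par.
  + by apply: alpha_solo; same_name_tac.
  + by apply: alpha_C; same_name_tac.
  apply: alpha_nu; apply: alpha_nu; apply: alpha_par.
  + by apply: alpha_solo; same_name_tac.
  apply: IH => //; [|by apply/negP => /Pw; lia|by same_name_tac].
  move=> a aP; have aw := Pw _ (pi_fn_names aP); rewrite [X in same_name _ _ X]/=.
  case: (eqVneq a x) => [->|ax]; first by same_name_tac.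
  have aP' : a \in pi_fn (PIn u x P) by rewrite /= !inE ax aP orbT.
  by have ra := rk _ aP'; have ea := er _ aP'; same_name_tac.
- have [ru rx rP] := below_out rk; rewrite /trans_at -/trans_at.
  set A := v |` _; set w := fresh A; set y := fresh (w |` A).
  set v1 := fresh (y |` (w |` A)).
  have hA a : a \in A -> a < w by exact: ltn_fresh.
  have wy : w < y by rewrite ltn_fresh ?fset1U1.
  have yv1 : y < v1 by rewrite ltn_fresh ?fset1U1.
  have vw : v < w by rewrite hA ?fset1U1.
  have uw : u < w by rewrite hA // !inE eqxx orbT.
  have xw : x < w by rewrite hA // !inE eqxx !orbT.
  have Pw a : a \in pi_names P -> a < w by move=> aP; rewrite hA // !inE aP !orbT.
  have uu : same_name e u (r u) by apply: er; rewrite fset1U1.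
  have xx : same_name e x (r x) by apply: er; rewrite /= !inE eqxx orbT.
  apply: alpha_nu; apply: alpha_nu; apply: alpha_par; first apply: alpha_par.
  + by apply: alpha_solo; same_name_tac.
  + by apply: alpha_C; same_name_tac.
  apply: alpha_nu; apply: alpha_par.
  + by apply: alpha_solo; same_name_tac.
  apply: IH => //; [|by apply/negP => /Pw; lia|by same_name_tac].
  move=> a aP; have aw := Pw _ (pi_fn_names aP).
  have aP' : a \in pi_fn (POut u x P) by rewrite /= !inE aP !orbT.
  by have ra := rk _ aP'; have ea := er _ aP'; same_name_tac.
- have [rP rQ] := below_par rk; move: vP; rewrite /= !inE negb_or => /andP[vP vQ].
  apply: alpha_par; [apply: IHP|apply: IHQ] => //.
  + by move=> a aP; apply: er; rewrite /= !inE aP.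
  + by move=> a aP; apply: er; rewrite /= !inE aP orbT.
  + by apply: below_leq rQ _; rewrite leq_addr.
  + by rewrite ltn_addr.
- move: vP; rewrite /= !inE negb_or => /andP[vx vP].
  apply: alpha_nu; apply: IH => //; last exact: ltnW.
  + move=> a aP; rewrite [X in same_name _ _ X]/=.
    case: (eqVneq a x) => [->|ax]; first by same_name_tac.
    have aP' : a \in pi_fn (PNu x P) by rewrite /= !inE ax aP.
    by have ra := rk _ aP'; have ea := er _ aP'; same_name_tac.
  + exact: below_nu.
  + by same_name_tac.
Qed.

Lemma alpha_rep P : alpha_eq (trans P) (rep P).
Proof.
apply: alpha_nu; apply: alpha_par; last first.
  by apply: alpha_C; [exact: same_name_head|lia].
(* The two outermost names may differ, since one avoids all written names and the other only the
   free ones. Both exceed every free name, so each free name still matches itself. *)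
have fv a : a \in pi_fn P -> a < fresh (pi_fn P) by exact: ltn_fresh.
have fw a : a \in pi_names P -> a < fresh (pi_names P) by exact: ltn_fresh.
apply: alpha_rep_at => // [a aP|a /fv||]; last exact: same_name_head.
- by have av := fv _ aP; have aw := fw _ (pi_fn_names aP);
    apply: same_name_cons; [lia|lia|exact: eqxx].
- exact: leqW.
- exact: fresh_notin.
Qed.

(** * Typing *)

(** Undefinedness from [k] on makes every numbered binder fresh for the environment. It also bounds
    by [k] each name that has a type, so no separate bound on [r] is assumed. *)
Definition env_ok (G : env) (r : name -> name) (P : pi_term) (v k : name) : Prop :=
  [/\ forall x, k <= x -> G.[? x] = None,
      forall a, a \in pi_fn P -> G.[? r a] = Some W & G.[? v] = Some V].

(** The solos of [rep_at r P v k] with the subject types already evaluated; the protocols are then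
    explicit, and acyclicity can be treated without environments. *)
Fixpoint rep_solos (r : name -> name) (P : pi_term) (v k : name) : seq solo :=
  match P with
  | PNil => [::]
  | PIn u x P =>
      [:: Solo Output v [:: r u; k; k.+1] (Some V),
          Solo Input k.+1 [:: k.+2; k.+2; k.+1] (Some V),
          Solo Input k [:: k.+3; v; k.+4] (Some W)
        & rep_solos [eta r with x |-> k.+3] P k.+4 k.+1.+4]
  | POut u x P =>
      [:: Solo Output v [:: r u; k; k.+1] (Some V),
          Solo Input k.+1 [:: k.+2; k.+2; k.+1] (Some V),
          Solo Output k [:: r x; k.+3; v] (Some W)
        & rep_solos r P k.+3 k.+4]
  | PPar P Q => rep_solos r P v k ++ rep_solos r Q v (k + nbinders P)
  | PNu x P => rep_solos [eta r with x |-> k] P v k.+1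
  end.

Lemma typed_nu_fresh (G : env) x U P :
  G.[? x] = None -> typed G.[x <- U] P -> typed G (SNu x U P).
Proof. by move=> Gx; apply: typed_nu; rewrite -fndSome Gx. Qed.

Lemma env_lt (G : env) k x U :
  (forall y, k <= y -> G.[? y] = None) -> G.[? x] = Some U -> x < k.
Proof. by move=> Gk Gx; rewrite ltnNge; apply/negP => /Gk; rewrite Gx. Qed.

Lemma fnd_set_neq (G : env) x y U o :
  y != x -> G.[? y] = o -> G.[x <- U].[? y] = o.
Proof. by move=> /negPf ne <-; rewrite fnd_set ne. Qed.

Lemma fnd_set_eq (G : env) x U : G.[x <- U].[? x] = Some U.
Proof. by rewrite fnd_set eqxx. Qed.

Ltac env_tac :=
  repeat first [by [] | exact: fnd_set_eq | apply: fnd_set_neq; [lia|]];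
  try by match goal with H : context [fnd _ _ = None] |- _ => apply: H; lia end.

(** Typing and the list of solos are obtained in one induction, because both rest on the same
    lookups in the extended environment. *)
Lemma typed_rep_at P (G : env) r v k : env_ok G r P v k ->
  typed G (rep_at r P v k) /\ solos G (rep_at r P v k) = rep_solos r P v k.
Proof.
elim: P G r v k => [|u x P IH|u x P IH|P IHP Q IHQ|x P IH] G r v k [Gk Gr Gv].
- by split=> //; apply: typed_nil.
- have Gu : G.[? r u] = Some W by apply: Gr; rewrite fset1U1.
  have vk := env_lt Gk Gv; have uk := env_lt Gk Gu.
  (* [k.+2] is not added here: the restriction inside [C(y)] does not scope over the
     continuation. *)
  have [|tP sP] := IH G.[k <- W].[k.+1 <- V].[k.+3 <- W].[k.+4 <- V]
                      [eta r with x |-> k.+3] k.+4 k.+1.+4.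
    split=> [y ky|a aP|]; rewrite [X in fnd _ X]/=; env_tac.
    case: eqVneq => [_|ax]; env_tac.
    have Ga : G.[? r a] = Some W by apply: Gr; rewrite /= !inE ax aP orbT.
    by have ak := env_lt Gk Ga; env_tac.
  split.
    apply: typed_nu_fresh; first by env_tac.
    apply: typed_nu_fresh; first by env_tac.
    apply: typed_par; first apply: typed_par.
    + by apply: typed_soloV; env_tac.
    + by apply: typed_nu_fresh; [env_tac|apply: typed_soloV; env_tac].
    apply: typed_nu_fresh; first by env_tac.
    apply: typed_nu_fresh; first by env_tac.
    by apply: typed_par => //; apply: typed_soloW; env_tac.
  rewrite /= sP; congr [:: Solo _ _ _ _, Solo _ _ _ _, Solo _ _ _ _ & _]; env_tac.
- have Gu : G.[? r u] = Some W by apply: Gr; rewrite fset1U1.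
  have Gx : G.[? r x] = Some W by apply: Gr; rewrite /= !inE eqxx orbT.
  have vk := env_lt Gk Gv; have uk := env_lt Gk Gu; have xk := env_lt Gk Gx.
  have [|tP sP] := IH G.[k <- W].[k.+1 <- V].[k.+3 <- V] r k.+3 k.+4.
    split=> [y ky|a aP|]; env_tac.
    have Ga : G.[? r a] = Some W by apply: Gr; rewrite /= !inE aP !orbT.
    by have ak := env_lt Gk Ga; env_tac.
  split.
    apply: typed_nu_fresh; first by env_tac.
    apply: typed_nu_fresh; first by env_tac.
    apply: typed_par; first apply: typed_par.
    + by apply: typed_soloV; env_tac.
    + by apply: typed_nu_fresh; [env_tac|apply: typed_soloV; env_tac].
    apply: typed_nu_fresh; first by env_tac.
    by apply: typed_par => //; apply: typed_soloW; env_tac.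
  rewrite /= sP; congr [:: Solo _ _ _ _, Solo _ _ _ _, Solo _ _ _ _ & _]; env_tac.
- have [|tP sP] := IHP G r v k.
    by split=> // a aP; apply: Gr; rewrite /= !inE aP.
  have [|tQ sQ] := IHQ G r v (k + nbinders P).
    split=> // [y ky|a aP]; first by apply: Gk; lia.
    by apply: Gr; rewrite /= !inE aP orbT.
  by split; [apply: typed_par|rewrite /= sP sQ].
- have vk := env_lt Gk Gv.
  have [|tP sP] := IH G.[k <- W] [eta r with x |-> k] v k.+1.
    split=> [y ky|a aP|]; rewrite [X in fnd _ X]/=; env_tac.
    case: eqVneq => [_|ax]; env_tac.
    have Ga : G.[? r a] = Some W by apply: Gr; rewrite /= !inE ax aP.
    by have ak := env_lt Gk Ga; env_tac.
  by split; [apply: typed_nu_fresh => //; env_tac|].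
Qed.

Lemma typed_rep P (v := fresh (pi_fn P)) (z := v.+1 + nbinders P) :
  typed (free_env P) (rep P) /\
  solos (free_env P) (rep P)
  = rcons (rep_solos id P v v.+1) (Solo Input v [:: z; z; v] (Some V)).
Proof.
have Gk y : v <= y -> (free_env P).[? y] = None.
  move=> vy; apply: not_fnd; apply/negP => /ltn_fresh; rewrite -/v; lia.
have Gr a : a \in pi_fn P -> (free_env P).[? a] = Some W.
  by move=> aP; rewrite (in_fnd aP) ffunE.
have [|tP sP] := @typed_rep_at P (free_env P).[v <- V] id v v.+1.
  split=> [y vy|a aP|]; env_tac.
  by have av := ltn_fresh aP; apply: fnd_set_neq; [rewrite /v; lia|exact: Gr].
split.
  apply: typed_nu_fresh; first by env_tac.
  apply: typed_par => //; apply: typed_nu_fresh; first by env_tac.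
  by apply: typed_soloV; env_tac.
rewrite /= sP cats1; congr (rcons _ (Solo _ _ _ _)); env_tac.
Qed.

(** * Acyclicity *)

(** By the protocols, an input prefix receives [k, k.+1], then [k.+2], then [k.+3, k.+4], and an
    output prefix stops at [k.+3]: exactly the numbers of its binders, in order. Only a name
    restricted by [PNu] is bound without being received, hence a subsequence and not an equality. *)
Lemma rep_solos_received P r v k :
  subseq (flatten (map received (rep_solos r P v k))) (iota k (nbinders P)).
Proof.
elim: P r v k => //= [u x P IH|u x P IH|P IHP Q IHQ|x P IH] r v k.
- by rewrite !eqxx.
- by rewrite !eqxx.
- by rewrite map_cat flatten_cat iotaD cat_subseq.
- exact: subseq_trans (IH _ _ _) (subseq_cons _ _).
Qed.

Lemma received_bound P r v k s x : s \in rep_solos r P v k ->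
  x \in received s -> k <= x < k + nbinders P.
Proof.
move=> sP xs; rewrite -mem_iota; apply: (mem_subseq (rep_solos_received P r v k)).
by apply/flatten_mapP; exists s.
Qed.

Lemma rep_solos_received_nil P r v k :
  {in rep_solos r P v k, forall s, received s != [::]}.
Proof.
elim: P r v k => //= [u x P IH|u x P IH|P IHP Q IHQ] r v k s.
- by rewrite !inE => /or4P[/eqP->|/eqP->|/eqP->|/IH].
- by rewrite !inE => /or4P[/eqP->|/eqP->|/eqP->|/IH].
- by rewrite mem_cat => /orP[/IHP|/IHQ].
Qed.

Lemma rep_solos_subj P r v k s : s \in rep_solos r P v k ->
  subj s = v /\ pol s = Output \/ k <= subj s < k + nbinders P.
Proof.
elim: P r v k => //= [u x P IH|u x P IH|P IHP Q IHQ|x P IH] r v k.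
- rewrite !inE => /or4P[/eqP->|/eqP->|/eqP->|/IH H] /=; [by left|right; lia..].
- rewrite !inE => /or4P[/eqP->|/eqP->|/eqP->|/IH H] /=; [by left|right; lia..].
- by rewrite mem_cat => /orP[/IHP|/IHQ] [H|H]; [left|right; lia|left|right; lia].
- by move=> /IH [H|H]; [left|right; lia].
Qed.

(** This is the scoping information used for AC3. The inner [v'] and the name bound by a prefix or
    restriction pass into the third alternative, since their numbers belong to the enlarged
    block. *)
Lemma rep_solos_objs P r v k s x : s \in rep_solos r P v k -> x \in objs s ->
  [\/ x = v, exists2 a, a \in pi_fn P & x = r a | k <= x < k + nbinders P].
Proof.
elim: P r v k => //= [u y P IH|u y P IH|P IHP Q IHQ|y P IH] r v k.
- have ur : exists2 a, a \in u |` pi_fn P `\ y & r u = r a.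
    by exists u; rewrite ?fset1U1.
  rewrite !inE => /or4P[/eqP->|/eqP->|/eqP->|sP] /=; rewrite ?inE.
  + by case/or3P=> /eqP->; [exact: Or32|apply: Or33; lia|apply: Or33; lia].
  + by case/or3P=> /eqP->; apply: Or33; lia.
  + by case/or3P=> /eqP->; [apply: Or33; lia|exact: Or31|apply: Or33; lia].
  move=> /(IH _ _ _ sP)[->|[a aP /=]|]; try by move=> *; apply: Or33; lia.
  case: eqP => [_ ->|/eqP ay ->]; first by apply: Or33; lia.
  by apply: Or32; exists a; rewrite // !inE ay aP orbT.
- have ur : exists2 a, a \in u |` (y |` pi_fn P) & r u = r a.
    by exists u; rewrite ?fset1U1.
  have yr : exists2 a, a \in u |` (y |` pi_fn P) & r y = r a.
    by exists y; rewrite // !inE eqxx orbT.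
  rewrite !inE => /or4P[/eqP->|/eqP->|/eqP->|sP] /=; rewrite ?inE.
  + by case/or3P=> /eqP->; [exact: Or32|apply: Or33; lia|apply: Or33; lia].
  + by case/or3P=> /eqP->; apply: Or33; lia.
  + by case/or3P=> /eqP->; [exact: Or32|apply: Or33; lia|exact: Or31].
  move=> /(IH _ _ _ sP)[->|[a aP ->]|]; try by move=> *; apply: Or33; lia.
  by apply: Or32; exists a; rewrite // !inE aP !orbT.
- rewrite mem_cat => /orP[/IHP H /H|/IHQ H /H] [->|[a aP ->]|];
    try (by apply: Or31); try (by move=> *; apply: Or33; lia);
    by apply: Or32; exists a; rewrite // !inE aP ?orbT.
- move=> /IH H /H [->|[a aP /=]|];
    [exact: Or31| |by move=> ?; apply: Or33; lia].
  case: eqP => [_ ->|/eqP ay ->]; first by apply: Or33; lia.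
  by apply: Or32; exists a; rewrite // !inE ay aP.
Qed.

(** The subjects [v], [k.+1] and [k] of a prefix differ from each other and from those of its
    continuation, which start at the number of [v']. Parallel components use disjoint blocks, so
    they can share only the subject [v], on which both have outputs. *)
Lemma rep_solos_pol P r v k : v < k ->
  {in rep_solos r P v k &, forall s t, subj s = subj t -> pol s = pol t}.
Proof.
elim: P r v k => //= [u x P IH|u x P IH|P IHP Q IHQ|x P IH] r v k vk s t.
- rewrite !inE => /or4P[/eqP->|/eqP->|/eqP->|sP] /or4P[/eqP->|/eqP->|/eqP->|tP] //=;
    try lia; try (have [[ts _]|ts] := rep_solos_subj tP);
    try (have [[ss _]|ss] := rep_solos_subj sP); try lia; apply: IH sP tP => //; lia.
- rewrite !inE => /or4P[/eqP->|/eqP->|/eqP->|sP] /or4P[/eqP->|/eqP->|/eqP->|tP] //=;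
    try lia; try (have [[ts _]|ts] := rep_solos_subj tP);
    try (have [[ss _]|ss] := rep_solos_subj sP); try lia; apply: IH sP tP => //; lia.
- rewrite !mem_cat => /orP[sP|sP] /orP[tP|tP];
    try by (apply: IHP sP tP || apply: IHQ sP tP); lia.
  + by have [[ss ->]|ss] := rep_solos_subj sP;
      have [[ts ->]|ts] := rep_solos_subj tP => //; lia.
  + by have [[ss ->]|ss] := rep_solos_subj sP;
      have [[ts ->]|ts] := rep_solos_subj tP => //; lia.
- by apply: IH; lia.
Qed.

(** Only the [z] of some [C(y)], an input, is both sent and received by one solo: elsewhere the sent
    names are older than the block and the received ones belong to it. *)
Lemma rep_solos_send P r v k : v < k -> below r P k ->
  {in rep_solos r P v k, forall s x,
     (x, Send) \in occs s -> x \in received s -> pol s = Input}.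
Proof.
elim: P r v k => //= [u x P IH|u x P IH|P IHP Q IHQ|x P IH] r v k vk.
- move=> /below_in[ru rP] s; rewrite !inE => /or4P[/eqP->|/eqP->|/eqP->|sP] //=.
  + move=> y; rewrite !inE !xpair_eqE /= ?andbT ?andbF ?orbF; lia.
  + by apply: IH sP.
- move=> /below_out[ru rx rP] s; rewrite !inE => /or4P[/eqP->|/eqP->|/eqP->|sP] //=.
  + move=> y; rewrite !inE !xpair_eqE /= ?andbT ?andbF ?orbF; lia.
  + move=> y; rewrite !inE !xpair_eqE /= ?andbT ?andbF ?orbF; lia.
  + by apply: IH sP.
- move=> /below_par[rP rQ] s; rewrite mem_cat => /orP[]; first exact: IHP.
  by apply: IHQ; [lia|apply: below_leq rQ _; lia].
- by move=> /below_nu; apply: IH; lia.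
Qed.

(** The shape common to both prefixes: [o] is the output on [v], [c] is [C(y)] and [i] is the solo
    on [w]. Here [o] receives the subjects of [c] and [i], while [i] receives the subject through
    which the continuation [S] is entered. *)
Lemma reach_prefix o c i S :
  tri_solo o c -> tri_solo o i ->
  (forall t, t \in S -> exists2 s, s \in S & tri_solo i s /\ reach S s t) ->
  {in [:: o, c, i & S], forall t, reach [:: o, c, i & S] o t} /\
  {in S, forall t, reach [:: o, c, i & S] i t}.
Proof.
move=> oc oi iS.
have iR t : t \in S -> reach [:: o, c, i & S] i t.
  move=> /iS[s sS [si st]]; apply: reach_step si _ _; first by rewrite !inE sS !orbT.
  by apply: reach_sub st => q qS; rewrite !inE qS !orbT.
split=> // t; rewrite !inE => /or4P[/eqP->|/eqP->|/eqP->|/iR it].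
- exact: reach_refl.
- by apply: reach_step oc _ (reach_refl _ _); rewrite !inE eqxx orbT.
- by apply: reach_step oi _ (reach_refl _ _); rewrite !inE eqxx !orbT.
- by apply: reach_step oi _ it; rewrite !inE eqxx !orbT.
Qed.

(** At a prefix the required solo is its first output, which reaches the whole list; the
    continuation is entered through [v'], which the solo on [w] receives. *)
Lemma rep_solos_reach P r v k t : t \in rep_solos r P v k ->
  exists2 s, s \in rep_solos r P v k & subj s = v /\ reach (rep_solos r P v k) s t.
Proof.
elim: P r v k t => //= [u x P IH|u x P IH|P IHP Q IHQ|x P IH] r v k t tS.
- eexists; first exact: mem_head; split=> //.
  apply: (proj1 (reach_prefix _ _ _)) tS;
    rewrite /tri_solo ?inE ?eqxx ?orbT // => q /IH[s sS [sv sq]].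
  by exists s => //; split=> //; rewrite sv !inE eqxx orbT.
- eexists; first exact: mem_head; split=> //.
  apply: (proj1 (reach_prefix _ _ _)) tS;
    rewrite /tri_solo ?inE ?eqxx ?orbT // => q /IH[s sS [sv sq]].
  by exists s => //; split=> //; rewrite sv !inE eqxx.
- move: tS; rewrite mem_cat => /orP[/IHP|/IHQ] [s sS [sv st]]; exists s;
    rewrite ?mem_cat ?sS ?orbT //; split=> //;
    by apply: reach_sub st => q qS; rewrite mem_cat qS ?orbT.
- exact: IH.
Qed.

(** At a prefix, [o] reaches everything; the name received by [c] occurs in [c] only; the names
    received by [i] occur in [i] and in the continuation, all of which [i] reaches; names received
    in the continuation stay there. *)
Lemma rep_solos_binder P r v k : v < k -> below r P k ->
  {in rep_solos r P v k &, forall s t x,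
     x \in received s -> x \in objs t -> reach (rep_solos r P v k) s t}.
Proof.
elim: P r v k => //= [u y P IH|u y P IH|P IHP Q IHQ|y P IH] r v k vk.
- move=> rk; have [ru rP] := below_in rk.
  set o := Solo Output _ _ _; set c := Solo Input k.+1 _ _; set i := Solo _ k _ _.
  set S := rep_solos _ _ _ _.
  have [oR iR] : {in [:: o, c, i & S], forall t, reach [:: o, c, i & S] o t} /\
                 {in S, forall t, reach [:: o, c, i & S] i t}.
    apply: reach_prefix; rewrite /tri_solo ?inE ?eqxx ?orbT // => q.
    move=> /rep_solos_reach[s sS [sv sq]].
    by exists s => //; split=> //; rewrite sv !inE eqxx orbT.
  (* The gap from [k] to [k.+2] says that [w], [y] and the [z] of [C(y)] do not occur in the
     continuation. *)
  have objS t x : t \in S -> x \in objs t -> x < k \/ k.+2 < x.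
    move=> tS /(rep_solos_objs tS)[->|[a aP /=]|]; try by right; lia.
    case: eqP => [_|/eqP ay] ->; first by right; lia.
    by left; apply: rk; rewrite /= !inE ay aP orbT.
  (* Every object of the three prefix solos is at most [k.+4], so none is received in the
     continuation. *)
  have recS s x : s \in S -> x \in received s -> k.+4 < x.
    by move=> sS /(received_bound sS)/andP[].
  move=> s t; rewrite [s \in _]inE => /orP[/eqP-> tS|]; first by move=> *; apply: oR.
  rewrite !inE => /or3P[/eqP->|/eqP->|sS] /or4P[/eqP->|/eqP->|/eqP->|tS] x;
    rewrite ?[_ \in received c]inE ?[_ \in received i]inE ?inE /=;
    try (by move=> xs xt; exfalso; lia);
    try (by move=> *; apply: reach_refl).
  + by move=> xc /(objS _ _ tS); lia.
  + by move=> *; apply: iR.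
  + by move=> /(recS _ _ sS); lia.
  + by move=> /(recS _ _ sS); lia.
  + by move=> /(recS _ _ sS); lia.
  + move=> xs xt; apply: (@reach_sub S) => [q qS|]; first by rewrite !inE qS !orbT.
    by apply: IH xs xt.
- move=> rk; have [ru ry rP] := below_out rk.
  set o := Solo Output v _ _; set c := Solo Input k.+1 _ _; set i := Solo _ k _ _.
  set S := rep_solos _ _ _ _.
  have [oR iR] : {in [:: o, c, i & S], forall t, reach [:: o, c, i & S] o t} /\
                 {in S, forall t, reach [:: o, c, i & S] i t}.
    apply: reach_prefix; rewrite /tri_solo ?inE ?eqxx ?orbT // => q.
    move=> /rep_solos_reach[s sS [sv sq]].
    by exists s => //; split=> //; rewrite sv !inE eqxx.
  have objS t x : t \in S -> x \in objs t -> x < k \/ k.+2 < x.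
    move=> tS /(rep_solos_objs tS)[->|[a aP ->]|]; try by right; lia.
    by left; apply: rk; rewrite /= !inE aP !orbT.
  have recS s x : s \in S -> x \in received s -> k.+3 < x.
    by move=> sS /(received_bound sS)/andP[].
  move=> s t; rewrite [s \in _]inE => /orP[/eqP-> tS|]; first by move=> *; apply: oR.
  rewrite !inE => /or3P[/eqP->|/eqP->|sS] /or4P[/eqP->|/eqP->|/eqP->|tS] x;
    rewrite ?[_ \in received c]inE ?[_ \in received i]inE ?inE /=;
    try (by move=> xs xt; exfalso; lia);
    try (by move=> *; apply: reach_refl).
  + by move=> xc /(objS _ _ tS); lia.
  + by move=> *; apply: iR.
  + by move=> /(recS _ _ sS); lia.
  + by move=> /(recS _ _ sS); lia.
  + by move=> /(recS _ _ sS); lia.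
  + move=> xs xt; apply: (@reach_sub S) => [q qS|]; first by rewrite !inE qS !orbT.
    by apply: IH xs xt.
- move=> /below_par[rP rQ] s t; rewrite !mem_cat.
  set SP := rep_solos r P v k; set SQ := rep_solos r Q v _.
  have subP : {subset SP <= SP ++ SQ} by move=> q qS; rewrite mem_cat qS.
  have subQ : {subset SQ <= SP ++ SQ} by move=> q qS; rewrite mem_cat qS orbT.
  move=> /orP[sP|sP] /orP[tP|tP] x xs xt.
  + by apply: reach_sub subP _; apply: IHP xs xt.
  (* A name received on one side lies in that side's block, whereas the objects on the other side
     are [v], older names or members of the other block. *)
  + have := received_bound sP xs.
    by case: (rep_solos_objs tP xt) => [->|[a /rQ ra ->]|]; lia.
  + have := received_bound sP xs.
    by case: (rep_solos_objs tP xt) => [->|[a /rP ra ->]|]; lia.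
  + apply: reach_sub subQ _; apply: IHQ xs xt => //; first by lia.
    by apply: below_leq rQ _; lia.
- by move=> /below_nu; apply: IH; lia.
Qed.

Theorem theorem5p11 (P : pi_term) : acyclic (free_env P) (trans P).
Proof.
have [tP sP] := typed_rep P; have wP := well_named_rep P.
exists (rep P); split=> //; first exact: alpha_rep.
rewrite /acyclic_conditions sP.
have bnP : {subset bn (rep P) <= [predC fn (rep P)]} by move=> x; case: wP => _; apply.
move: bnP; rewrite [bn _]/= bn_rep_at; set v := fresh _ => bnP.
have rP : below id P v.+1 by move=> a /ltn_fresh; rewrite -/v /=; lia.
set z := v.+1 + _; set c := Solo _ _ _ _; set S := rep_solos _ _ _ _.
have cR : received c = [:: z] by [].
have uR : subseq (flatten (map received (rcons S c))) (iota v.+1 (nbinders P).+1).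
  rewrite map_rcons flatten_rcons cR -[(nbinders P).+1]addn1 iotaD.
  by apply: cat_subseq; [exact: rep_solos_received|].
have bR s x : s \in rcons S c -> x \in received s -> v < x.
  move=> sS xs; have : x \in iota v.+1 (nbinders P).+1.
    by apply: (mem_subseq uR); apply/flatten_mapP; exists s.
  by rewrite mem_iota; lia.
apply: list_acyclic.
- exact: subseq_uniq uR (iota_uniq _ _).
- move=> s; rewrite mem_rcons inE => /orP[/eqP->|] //.
  exact: rep_solos_received_nil.
- move=> s t sS tS eq_st ne_st q qS.
  (* All received names exceed [v]. Two solos of opposite polarities on one subject cannot both lie
     in [S], so one of them is [c], whose subject is [v]. *)
  suff sv : subj s = v.
    by rewrite /tri_solo sv; apply/negP => /(bR _ _ qS); rewrite ltnn.
  move: sS tS eq_st ne_st; rewrite !mem_rcons !inE.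
  case/orP=> [/eqP-> //|sS]; case/orP=> [/eqP-> //|tS].
  by move=> eq_st []; apply: (rep_solos_pol _ sS tS eq_st).
- have subS : {subset S <= rcons S c} by move=> q qS; rewrite mem_rcons inE qS orbT.
  move=> s t; rewrite !mem_rcons !inE.
  case/orP=> [/eqP->|sS]; case/orP=> [/eqP->|tS] x.
  + by move=> _ _; apply: reach_refl.
  (* [z] is numbered after the whole block, so it is no object of a solo in [S]. *)
  + rewrite cR inE => /eqP->.
    by case/(rep_solos_objs tS) => [|[a /rP ra]|]; rewrite /z; lia.
  + by move=> /(received_bound sS); rewrite !inE /= /z; lia.
  + by move=> xs xt; apply: reach_sub subS _; apply: rep_solos_binder xs xt.
- move=> s; rewrite mem_rcons inE => /orP[/eqP->|] //.
  exact: rep_solos_send.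
- move=> s sS x xs; apply: bnP; rewrite inE mem_cat.
  have : x \in iota v.+1 (nbinders P).+1.
    by apply: (mem_subseq uR); apply/flatten_mapP; exists s.
  by rewrite -[(nbinders P).+1]addn1 iotaD mem_cat => ->; rewrite orbT.
Qed.
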